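(* Consider a spherical 4-bar linkage with sector angles satisfying $\delta=\alpha$, $\gamma=\beta$, $\beta\neq\alpha$, $\alpha+\beta\neq\pi$ (a ''deltoid I''). (i) Finite solutions. There is only a single branch, diffeomorphic to a circle $S^1$, parametrized by $x$ as $$y=\frac{\sin(\beta-\alpha)x^2+\sin(\beta+\alpha)}{2x\sin\alpha},\qquad z=x,\qquad w=\frac{\sin(\alpha-\beta)x^2+\sin(\alpha+\beta)}{2x\sin\beta}.$$ (ii) Solutions at infinity. The solutions at infinity form another branch, diffeomorphic to a circle $S^1$: $$x\in\mathbb{R}\cup\{\infty\},\quad y\equiv\infty,\quad z=-x,\quad w\equiv\infty.$$
   Context: A spherical 4-bar linkage (equivalently, a degree-4 single-vertex rigid origami) is a closed chain of four great-circle arcs on the unit sphere with lengths (sector angles), in counter-clockwise cyclic order, $\alpha,\beta,\gamma,\delta\in(0,\pi)$. Its configuration is described by the folding angles (signed turning angles between consecutive arcs) $\rho_x,\rho_y,\rho_z,\rho_w\in\mathbb{R}/2\pi$, where $\rho_x$ is at the joint of $\alpha$ and $\beta$, $\rho_y$ of $\beta$ and $\gamma$, $\rho_z$ of $\gamma$ and $\delta$, $\rho_w$ of $\delta$ and $\alpha$. Write $x=\tan(\rho_x/2)$, $y=\tan(\rho_y/2)$, $z=\tan(\rho_z/2)$, $w=\tan(\rho_w/2)$, all in $\mathbb{R}\cup\{\infty\}$, the one-point compactification of the real line (folding angles $\pi$ and $-\pi$ are identified and correspond to $\infty$). Finite solutions are the flexes found with $x,y,z,w$ finite, the branch then being completed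 over $\mathbb{R}\cup\{\infty\}$; solutions at infinity are those with some of $x,y,z,w$ equal to $\infty$. *)

(* Defs.v *)
From mathcomp Require Import all_boot all_order all_algebra.
From mathcomp Require Import all_classical all_reals all_analysis.

Set Implicit Arguments.
Unset Strict Implicit.
Unset Printing Implicit Defensive.

Import Order.TTheory GRing.Theory Num.Theory.
Import numFieldNormedType.Exports.

Local Open Scope classical_set_scope.
Local Open Scope ring_scope.

Section linkage.
Variable R : realType.

(* A moving frame (position on the sphere, unit tangent, position x tangent) is
   stored as the columns of a rotation matrix F.  Travelling an arc of length a
   along the tangent replaces F by F *m arc_mx a; turning by the signed angle
   rho (counter-clockwise seen from outside) replaces it by F *m turn_mx rho. *)
Definition arc_mx (a : R) : 'M[R]_3 :=
  \matrix_(i, j) nth 0 (nth [::] [:: [:: cos a; - sin a; 0];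
                                     [:: sin a; cos a; 0];
                                     [:: 0; 0; 1]] i) j.

Definition turn_mx (rho : R) : 'M[R]_3 :=
  \matrix_(i, j) nth 0 (nth [::] [:: [:: 1; 0; 0];
                                     [:: 0; cos rho; - sin rho];
                                     [:: 0; sin rho; cos rho]] i) j.

(* The four arcs form a closed chain with the given turning angles iff the
   frame returns to itself after one trip around the chain. *)
Definition closed_chain (alpha beta gamma delta : R)
    (rhox rhoy rhoz rhow : R) : Prop :=
  arc_mx alpha *m turn_mx rhox *m arc_mx beta *m turn_mx rhoy *m
  arc_mx gamma *m turn_mx rhoz *m arc_mx delta *m turn_mx rhow = 1%:M.

(* The real line completed by one point; [None] is the point at infinity. *)
Definition xreal : topologicalType := one_point_compactification R.

Definition fin (t : R) : xreal := Some t.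
Definition infty : xreal := None.
Definition xopp (t : xreal) : xreal := omap -%R t.

(* tan (rho / 2), equal to infinity when rho = pi modulo 2 pi *)
Definition half_tan (rho : R) : xreal :=
  if cos (rho / 2) == 0 then infty else fin (tan (rho / 2)).

(* The ambient space of the quadruples (x, y, z, w). *)
Definition xreal4 : topologicalType := (xreal * xreal * xreal * xreal)%type.

Definition solutions (alpha beta gamma delta : R) : set xreal4 :=
  [set q | exists rhox rhoy rhoz rhow : R,
     closed_chain alpha beta gamma delta rhox rhoy rhoz rhow /\
     q = (half_tan rhox, half_tan rhoy, half_tan rhoz, half_tan rhow)].

Definition finite_solutions (alpha beta gamma delta : R) : set xreal4 :=
  solutions alpha beta gamma delta `&`
  [set q | exists x y z w : R, q = (fin x, fin y, fin z, fin w)].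

Definition solutions_at_infinity (alpha beta gamma delta : R) : set xreal4 :=
  solutions alpha beta gamma delta `&`
  [set q | let: (x, y, z, w) := q in
     [\/ x = infty, y = infty, z = infty | w = infty]].

(* a / b, for a and b not both zero *)
Definition xquot (a b : R) : xreal := if b == 0 then infty else fin (a / b).

(* y and w are quotients of a polynomial of degree 2 in x (when
   beta <> alpha) by one of degree 1, so that they are infinite at
   x = infinity; at x = 0 they are infinite by [xquot]. *)
Definition deltoid_branch (alpha beta : R) (x : xreal) : xreal4 :=
  if x is Some t then
    (fin t,
     xquot (sin (beta - alpha) * t ^+ 2 + sin (beta + alpha))
           (2 * t * sin alpha),
     fin t,
     xquot (sin (alpha - beta) * t ^+ 2 + sin (alpha + beta))
           (2 * t * sin beta))
  else (infty, infty, infty, infty).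

Definition deltoid_branch_at_infinity (x : xreal) : xreal4 :=
  (x, infty, xopp x, infty).

(* f is of class C^k on the open set D: all iterated directional derivatives
   up to order k exist and are continuous on D.  (Used for U of finite
   dimension, where this is the usual notion.) *)
Fixpoint Ck_on (U V : normedModType R) (k : nat) (D : set U) (f : U -> V)
    : Prop :=
  (forall u, D u -> {for u, continuous f}) /\
  if k is k'.+1 then
    forall v : U, (forall u, D u -> derivable f u v) /\
                  Ck_on k' D (fun u => 'D_v f u)
  else True.

(* Smoothness of a map on an arbitrary subset A of a vector space: f extends
   to a C^oo map on a neighbourhood of each point of A. *)
Definition smooth_on (U V : normedModType R) (A : set U) (f : U -> V) : Prop :=
  forall u, A u -> exists (D : set U) (g : U -> V),
    [/\ open D, D u, (forall k, Ck_on k D g) &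
        forall u', D u' -> A u' -> g u' = f u'].

Definition diffeomorphic (U V : normedModType R) (A : set U) (B : set V)
    : Prop :=
  exists (f : U -> V) (g : V -> U),
    [/\ smooth_on A f, smooth_on B g,
        (forall u, A u -> B (f u) /\ g (f u) = u) &
        (forall v, B v -> A (g v) /\ f (g v) = v)].

Definition unit_circle : set 'rV[R]_2 :=
  [set u | u ord0 ord0 ^+ 2 + u ord0 ord_max ^+ 2 = 1].

(* (cos rho, sin rho) as a function of t = tan (rho / 2): this identifies the
   completed line, with its charts t and 1 / t, with the unit circle. *)
Definition circle_point (t : xreal) : 'rV[R]_2 :=
  if t is Some t then
    \row_j nth 0 [:: (1 - t ^+ 2) / (1 + t ^+ 2); 2 * t / (1 + t ^+ 2)] j
  else \row_j nth 0 [:: -1; 0] j.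

(* The resulting embedding of quadruples as a 4-torus in R^(4 x 2), through
   which subsets of [xreal4] get their differentiable structure. *)
Definition torus_point (q : xreal4) : 'M[R]_(4, 2) :=
  let: (x, y, z, w) := q in
  \matrix_(i < 4) circle_point (nth infty [:: x; y; z; w] i).

Definition diffeomorphic_to_circle (B : set xreal4) : Prop :=
  diffeomorphic (torus_point @` B) unit_circle.

End linkage.

Arguments infty {R}.

(* Main.v *)
Require Import Defs.
From mathcomp Require Import all_boot all_order all_algebra.
From mathcomp Require Import all_classical all_reals all_analysis.
From mathcomp Require Import ring lra.

Import Order.TTheory GRing.Theory Num.Theory.
Import numFieldNormedType.Exports.

Local Open Scope classical_set_scope.
Local Open Scope ring_scope.

(* Write the closing condition as an equality of two rotations, each a product
   along one half of the loop.  The (0, 0) entries give cos rhoz = cos rhox.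
   With P = deltoid_num alpha beta (cos rhox) and Q = sin alpha * sin rhox,
   which never vanish together, the rest of the first row says:
   - if sin rhoz = sin rhox, then tan (rhoy / 2) = P / Q;
   - if sin rhoz = - sin rhox, then (1 + cos rhoy) (P^2 + Q^2) = 0, that is
     rhoy = pi.
   The first columns treat rhow in the same way, with alpha and beta exchanged.
   So the solution set is the union of the two curves of the theorem, which meet
   at x = 0 and x = infinity, the only points of the first one at infinity.
   The first curve is the image of the compact completed line under a continuous
   map into a Hausdorff space, hence closed, and its finite points are dense.
   On the torus of pairs (cos rho, sin rho) both curves are graphs over their
   first coordinate of maps with rational components, so that projecting to the
   first factor is a diffeomorphism onto the circle. *)

(** * Closed chains *)

Section chain.
Context {R : realType}.
Implicit Types (a b : R).

(** The body has the shape of those of [arc_mx] and [turn_mx], which are therefore instances of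
    [mx3] up to conversion, so that [mulmx_mx3] rewrites their products. *)
Definition mx3 (a00 a01 a02 a10 a11 a12 a20 a21 a22 : R) : 'M[R]_3 :=
  \matrix_(i, j) nth 0 (nth [::] [:: [:: a00; a01; a02];
                                     [:: a10; a11; a12];
                                     [:: a20; a21; a22]] i) j.

Lemma mulmx_mx3 a00 a01 a02 a10 a11 a12 a20 a21 a22
    b00 b01 b02 b10 b11 b12 b20 b21 b22 :
  mx3 a00 a01 a02 a10 a11 a12 a20 a21 a22 *m
  mx3 b00 b01 b02 b10 b11 b12 b20 b21 b22 =
  mx3 (a00 * b00 + a01 * b10 + a02 * b20) (a00 * b01 + a01 * b11 + a02 * b21)
      (a00 * b02 + a01 * b12 + a02 * b22)
      (a10 * b00 + a11 * b10 + a12 * b20) (a10 * b01 + a11 * b11 + a12 * b21)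
      (a10 * b02 + a11 * b12 + a12 * b22)
      (a20 * b00 + a21 * b10 + a22 * b20) (a20 * b01 + a21 * b11 + a22 * b21)
      (a20 * b02 + a21 * b12 + a22 * b22).
Proof.
apply/matrixP => -[[|[|[|//]]] ?] -[[|[|[|//]]] ?]; rewrite !mxE !big_ord_recl
  big_ord0 !mxE/= addr0 addrA //.
Qed.

Lemma mx3P a00 a01 a02 a10 a11 a12 a20 a21 a22
    b00 b01 b02 b10 b11 b12 b20 b21 b22 :
  mx3 a00 a01 a02 a10 a11 a12 a20 a21 a22 =
  mx3 b00 b01 b02 b10 b11 b12 b20 b21 b22 <->
  [/\ [/\ a00 = b00, a01 = b01 & a02 = b02],
      [/\ a10 = b10, a11 = b11 & a12 = b12] &
      [/\ a20 = b20, a21 = b21 & a22 = b22]].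
Proof.
split=> [/matrixP H|[[-> -> ->] [-> -> ->] [-> -> ->]]//].
have {}H i (i3 : (i < 3)%N) j (j3 : (j < 3)%N) :=
  H (Ordinal i3) (Ordinal j3).
by split; split; [move: (H 0%N isT 0%N isT)|move: (H 0%N isT 1%N isT)|
  move: (H 0%N isT 2%N isT)|move: (H 1%N isT 0%N isT)|
  move: (H 1%N isT 1%N isT)|move: (H 1%N isT 2%N isT)|
  move: (H 2%N isT 0%N isT)|move: (H 2%N isT 1%N isT)|
  move: (H 2%N isT 2%N isT)]; rewrite !mxE/=.
Qed.

Lemma mx3_1 : 1%:M = mx3 1 0 0 0 1 0 0 0 1.
Proof.
by apply/matrixP => -[[|[|[|//]]] ?] -[[|[|[|//]]] ?]; rewrite !mxE.
Qed.

Lemma arc_mxV a : arc_mx a *m arc_mx (- a) = 1%:M.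
Proof.
rewrite mx3_1 mulmx_mx3 cosN sinN; have h := sin2cos2 a.
by apply/mx3P; split; split; ring: h.
Qed.

Lemma turn_mxV a : turn_mx a *m turn_mx (- a) = 1%:M.
Proof.
rewrite mx3_1 mulmx_mx3 cosN sinN; have h := sin2cos2 a.
by apply/mx3P; split; split; ring: h.
Qed.

(** With the loop cut this way, the first column on the left is free of [y] and the first row on the
    right is free of [w]. The (0, 0) entry thus relates [x] and [z] alone, the rest of the first row
    brings in only [y], and the rest of the first column only [w]. *)
Lemma closed_chainE a b c d x y z w : closed_chain a b c d x y z w <->
  arc_mx a *m turn_mx x *m arc_mx b *m turn_mx y =
  turn_mx (- w) *m arc_mx (- d) *m turn_mx (- z) *m arc_mx (- c).
Proof.
have A t := arc_mxV t; have T t := turn_mxV t.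
have A' (t : R) : arc_mx (- t) *m arc_mx t = 1%:M.
  by have := A (- t); rewrite opprK.
have T' (t : R) : turn_mx (- t) *m turn_mx t = 1%:M.
  by have := T (- t); rewrite opprK.
rewrite /closed_chain; split=> [H|->].
  rewrite -[RHS]mul1mx -H -!mulmxA (mulmxA (turn_mx w)) T mul1mx.
  by rewrite (mulmxA (arc_mx d)) A mul1mx (mulmxA (turn_mx z)) T mul1mx A mulmx1.
by rewrite -!mulmxA (mulmxA (arc_mx (- c))) A' mul1mx (mulmxA (turn_mx (- z))) T'
  mul1mx (mulmxA (arc_mx (- d))) A' mul1mx T'.
Qed.

(* Dividing numerator and denominator of the paper's formula for y by 1 + x^2
   turns it into deltoid_num a b (cos rhox) / (sin a * sin rhox); w is the same
   quotient with a and b exchanged. *)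
Definition deltoid_num (a b c : R) := cos a * sin b + sin a * cos b * c.

(** Multiplication by [turn_mx y] carries the last two entries (- P, sin a * sin x) of the first row
    of the three preceding factors to (P, sin a * sin z). The first column gives the relations for
    [w] in the same way. *)
Lemma closed_chain_deltoidE a b x y z w : closed_chain a b b a x y z w ->
  0 < sin a -> 0 < sin b ->
  let P := deltoid_num a b (cos x) in let P' := deltoid_num b a (cos x) in
  [/\ cos z = cos x,
      (1 + cos y) * P = sin y * (sin a * sin x) ,
      sin y * P + cos y * (sin a * sin x) = sin a * sin z,
      (1 + cos w) * P' = sin w * (sin b * sin z) &
      sin w * P' + cos w * (sin b * sin z) = sin b * sin x].
Proof.
move=> /closed_chainE; rewrite !mulmx_mx3 !cosN !sinN => + a0 b0 /=.
move=> /mx3P[[e00 e01 e02] [e10 _ _] [e20 _ _]].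
have zx : cos z = cos x.
  have ab0 : sin a * sin b != 0 by rewrite gt_eqF ?mulr_gt0.
  by apply: (mulfI ab0); lra.
by split=> //; rewrite /deltoid_num ?zx in e00 e01 e02 e10 e20 *; lra.
Qed.

(** The prescribed values are those with tan (y / 2) = P / Q and tan (w / 2) = P' / Q', over one
    denominator because P'^2 + Q'^2 = D as well. Each entry is then a rational identity modulo cos^2
    + sin^2 = 1. *)
Lemma closed_chain_deltoid a b x y z w :
  let P := deltoid_num a b (cos x) in let P' := deltoid_num b a (cos x) in
  let Q := sin a * sin x in let Q' := sin b * sin x in
  let D := P ^+ 2 + Q ^+ 2 in
  D != 0 -> cos z = cos x -> sin z = sin x ->
  cos y = (Q ^+ 2 - P ^+ 2) / D -> sin y = 2 * P * Q / D ->
  cos w = (Q' ^+ 2 - P' ^+ 2) / D -> sin w = 2 * P' * Q' / D ->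
  closed_chain a b b a x y z w.
Proof.
move=> P P' Q Q' D D0 cz sz cy sy cw sw; apply/closed_chainE.
rewrite !mulmx_mx3 !cosN !sinN cz sz cy sy cw sw.
have ha := sin2cos2 a; have hb := sin2cos2 b; have hx := sin2cos2 x.
rewrite /D /P /P' /Q /Q' /deltoid_num in D0 *.
move: (cos a) (sin a) (cos b) (sin b) (cos x) (sin x) ha hb hx D0
  => {P P' Q Q' D cz sz cy sy cw sw}.
move=> ca sa cb sb cx sx ha hb hx D0.
apply/mx3P; split; split.
all: by field: ha hb hx.
Qed.

End chain.

(** * Functions of class C^k *)

Section Ck.
Context {R : realType} {U : normedModType R}.

Lemma Ck_onW (V : normedModType R) k (D : set U) (f : U -> V) :
  Ck_on k.+1 D f -> Ck_on k D f.
Proof.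
elim: k f => [|k IH] f [fc fd]; first by split.
by split=> // v; have [fv /IH] := fd v.
Qed.

Lemma Ck_on_cst (V : normedModType R) k (D : set U) (c : V) :
  Ck_on k D (cst c : U -> V).
Proof.
elim: k c => [|k IH] c; split=> //; try by move=> u _; exact: cst_continuous.
move=> v; split=> [u _|]; first exact: derivable_cst.
rewrite (_ : (fun u => _) = cst 0); first exact: IH.
by apply/funext => u; rewrite derive_cst.
Qed.

Lemma Ck_onD (V : normedModType R) k (f g : U -> V) :
  Ck_on k setT f -> Ck_on k setT g -> Ck_on k setT (fun u => f u + g u).
Proof.
elim: k f g => [|k IH] f g [fc fd] [gc gd]; split=> //;
  try by move=> u _; apply: (@continuousD _ _ _ f g); [exact: fc|exact: gc].
move=> v; have [fv fk] := fd v; have [gv gk] := gd v.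
split=> [u uD|].
  by apply: (derivableD (f := f) (g := g)); [exact: fv|exact: gv].
rewrite (_ : (fun u => _) = (fun u => 'D_v f u + 'D_v g u)).
  exact: IH.
by apply/funext => u; rewrite (deriveD (f := f) (g := g)) //;
  [exact: fv|exact: gv].
Qed.

Lemma Ck_onM k (f g : U -> R) :
  Ck_on k setT f -> Ck_on k setT g -> Ck_on k setT (fun u => f u * g u).
Proof.
elim: k f g => [|k IH] f g fC gC; move: (fC) (gC) => [fc fd] [gc gd]; split=> //;
  try by move=> u _; apply: (@continuousM _ _ f g); [exact: fc|exact: gc].
move=> v; have [fv fk] := fd v; have [gv gk] := gd v.
split=> [u uD|].
  by apply: (derivableM (f := f) (g := g)); [exact: fv|exact: gv].
rewrite (_ : (fun u => _) =
    fun u => f u * 'D_v g u + g u * 'D_v f u).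
  by apply: Ck_onD; apply: IH => //; exact: Ck_onW.
by apply/funext => u; rewrite (deriveM (f := f) (g := g)) //;
  [exact: fv|exact: gv].
Qed.

Lemma Ck_onN k (f : U -> R) :
  Ck_on k setT f -> Ck_on k setT (fun u => - f u).
Proof.
move=> fC; rewrite (_ : (fun u => _) = fun u => -1 * f u).
  by apply: Ck_onM => //; exact: Ck_on_cst.
by apply/funext => u; rewrite mulN1r.
Qed.

Lemma Ck_onV k (f : U -> R) : (forall u, f u != 0) ->
  Ck_on k setT f -> Ck_on k setT (fun u => (f u)^-1).
Proof.
move=> f0; elim: k f f0 => [|k IH] f f0 fC; move: (fC) => [fc fd]; split=> //;
  try by move=> u _; apply: cvgV => //; exact: fc.
move=> v; have [fv fk] := fd v.
split=> [u uD|]; first by apply: derivableV => //; exact: fv.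
(* The derivative of the inverse contains the inverse again, at one order less. *)
have Vk : Ck_on k setT (fun u => (f u)^-1) by apply: IH => //; exact: Ck_onW.
rewrite (_ : (fun u => _) =
    fun u => - ((f u)^-1 * ((f u)^-1 * 'D_v f u))).
  by apply: Ck_onN; apply: Ck_onM => //; exact: Ck_onM.
apply/funext => u; rewrite deriveV //; last exact: fv.
by rewrite /= scaleNr expr2 invfM -scalerA.
Qed.

Lemma Ck_on_linear (V : normedModType R) k (D : set U) (f : {linear U -> V}) :
  continuous f -> Ck_on k D f.
Proof.
move=> fc; case: k => [|k]; split=> //; try by move=> u _; exact: fc.
move=> v; split=> [u _|].
  by apply: diff_derivable; exact: linear_differentiable.
rewrite (_ : (fun u => _) = cst (f v)); first exact: Ck_on_cst.
apply/funext => u; rewrite deriveE; last exact: linear_differentiable.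
by rewrite diff_lin.
Qed.

Lemma mx_continuous m n (T : topologicalType) (f : T -> 'M[R]_(m, n)) (x : T) :
  (forall i j, {for x, continuous (fun u => f u i j)}) ->
  {for x, continuous f}.
Proof.
move=> fc; apply/cvgrPdist_le => /= e e0; near=> t.
rewrite /Num.Def.normr/= mx_normrE (bigmax_le _ (ltW e0))//= => i _.
rewrite !mxE/=.
move: i; near: t; apply: filter_forall => /= i.
by have /cvgrPdist_le := fc i.1 i.2; exact.
Unshelve. all: by end_near. Qed.

Lemma Ck_on_mx m n k (f : U -> 'M[R]_(m.+1, n.+1)) :
  (forall i j, Ck_on k setT (fun u => f u i j)) -> Ck_on k setT f.
Proof.
elim: k f => [|k IH] f fC.
  by split=> // u _; apply: mx_continuous => i j; have [+ _] := fC i j; exact.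
split.
  by move=> u _; apply: mx_continuous => i j; have [+ _] := fC i j; exact.
move=> v.
have fv u : derivable f u v.
  by apply/derivable_mxP => i j; have [_ /(_ v)[+ _]] := fC i j; exact.
split=> [u _|]; first exact: fv.
apply: IH => i j; have [_ /(_ v)[_ +]] := fC i j.
rewrite (_ : (fun u => 'D_v (fun u => f u i j) u) = (fun u => ('D_v f u) i j)) //.
by apply/funext => u; rewrite derive_mx // mxE.
Qed.

(** All extensions used below are global, which is why the rules for sums, products and inverses are
    stated on [setT]. *)
Lemma smooth_on_Ck (V : normedModType R) (A : set U) (f : U -> V) :
  (forall k, Ck_on k setT f) -> smooth_on A f.
Proof. by move=> fC u _; exists setT, f; split=> //; exact: openT. Qed.

End Ck.

Lemma Ck_on_coord (R : realType) m n k (D : set 'M[R]_(m.+1, n.+1)) i j :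
  Ck_on k D (fun u : 'M[R]_(m.+1, n.+1) => u i j).
Proof.
(* The [@] keeps the body of [f] transparent, so that [f] converts to the entry map. *)
have @f : {linear 'M[R]_(m.+1, n.+1) -> R}.
  by exists (fun N : 'M[R]_(_, _) => N i j); do 2![eexists]; do ?[constructor];
     rewrite ?mxE// => ? *; rewrite ?mxE//; move=> ?; rewrite !mxE.
exact: (Ck_on_linear _ k D f (@coord_continuous _ _ _ i j)).
Qed.

(** * Topology of the completed line *)

Section xreal.
Context {R : realType}.
Implicit Types (A : set (xreal R)) (t : R).

(** Compact subsets of the line are bounded and segments are compact, so the complements of segments
    form a base at infinity. *)
Lemma nbhs_inftyP A : nbhs (infty : xreal R) A <->
  A infty /\ exists M : R, forall t, M < `|t| -> A (fin t).
Proof.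
split=> [[C [cC _] CA]|[A0 [M AM]]].
  split; first by apply: CA; right.
  have [M [_ CM]] := compact_bounded cC.
  (* [compact_bounded] provides a bound by each number above [M], not by [M] itself. *)
  exists (M + 1) => t Mt; apply: CA; left; exists t => //= Ct.
  have M1 : M < M + 1 by rewrite ltrDl.
  have tM : `|t| <= M + 1 := CM _ M1 t Ct.
  by rewrite ltNge tM in Mt.
exists `[- M, M]%classic.
  by split; [exact: segment_compact|exact: interval_closed].
move=> [t [[u /= uM [<-]]|//]|_ //]; apply: AM.
by rewrite ltNge; apply/negP; rewrite ler_norml => uM'; apply: uM; rewrite in_itv.
Qed.

Lemma cvg_infty (T : Type) (F : set_system T) (f : T -> xreal R) :
  Filter F ->
  (forall M : R, \forall x \near F, if f x is Some t then M < `|t| else true) ->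
  f @ F --> (infty : xreal R).
Proof.
move=> FF fM A /nbhs_inftyP[A0 [M AM]]; apply: filterS (fM M) => x /=.
by case: (f x) => [t /AM|_].
Qed.

Lemma cvg_fin (T : Type) (F : set_system T) (f : T -> R) t :
  Filter F -> f @ F --> t -> (fun x => fin (f x)) @ F --> (fin t).
Proof. by move=> FF ft A; exact: ft. Qed.

Lemma xreal_hausdorff : hausdorff_space (xreal R).
Proof.
apply: one_point_compactification_hausdorff (@Rhausdorff R).
exact: locally_compactR.
Qed.

(** If b = 0 then a is nonzero: eventually |f| is at least |a| / 2 and |g| is at most (|a| / 2) /
    (|M| + 1), so the quotient is infinite or exceeds M in absolute value. *)
Lemma cvg_xquot (T : Type) (F : set_system T) (f g : T -> R) (a b : R) :
  Filter F -> (a, b) != (0, 0) -> f @ F --> a -> g @ F --> b ->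
  (fun x => xquot (f x) (g x)) @ F --> xquot a b.
Proof.
move=> FF ab fa gb; rewrite {2}/xquot; case: eqP => [b0|/eqP b0].
  apply: cvg_infty => M; rewrite b0 in ab gb.
  have a0 : a != 0 by apply: contraNneq ab => ->.
  have a2 : 0 < `|a| / 2 by rewrite divr_gt0 ?normr_gt0.
  have M0 : 0 < `|M| + 1 by rewrite ltr_wpDl.
  near=> x; rewrite /xquot; case: ifPn => // gx0.
  apply: (@lt_le_trans _ _ (`|M| + 1)); first by rewrite ltr_pwDr// ler_norm.
  rewrite normrM normfV ler_pdivlMr ?normr_gt0//.
  apply: (@le_trans _ _ (`|a| / 2)).
    rewrite mulrC -ler_pdivlMr// -[leLHS]normrN -[- _]add0r; near: x.
    by apply: cvgr_dist_le => //; rewrite divr_gt0.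
  near: x.
  have : (fun x => `|f x|) @ F --> `|a| by exact: cvg_norm.
  move/cvgr_ge; apply; rewrite ltr_pdivrMr// ltr_pMr ?normr_gt0//.
  by rewrite ltr1n.
apply: (cvg_trans _ (cvg_fin _ _ _ _ _ (cvgM fa (cvgV b0 gb)))).
apply: near_eq_cvg.
near=> x.
rewrite /xquot ifF//; apply/negbTE; near: x.
by apply: cvgr_neq0 b0.
Unshelve. all: by end_near. Qed.

Lemma range_closed (T S : topologicalType) (f : T -> S) : compact [set: T] ->
  hausdorff_space S -> continuous f -> closed (range f).
Proof.
move=> Tc SH fc; apply: compact_closed => //.
by apply: continuous_compact => //; exact: continuous_subspaceT.
Qed.

(** The two missing points are 0, approached by [e / 2], and infinity, approached by [|M| + 1]. *)
Lemma dense_fin_neq0 (x : xreal R) : closure (@fin R @` [set t : R | t != 0]) x.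
Proof.
case: x => [t|] A.
  move=> tA; have : (nbhs t (@fin R @^-1` A)) by exact: tA.
  have [->|t0] := eqVneq t 0; last first.
    move=> /nbhs_singleton At; exists (fin t); split=> //; by exists t.
  move=> [e /= e0 eA]; exists (fin (e / 2)); split.
    exists (e / 2) => //=; by rewrite gt_eqF ?divr_gt0.
  apply: eA; rewrite /= sub0r normrN gtr0_norm ?divr_gt0//.
  by rewrite ltr_pdivrMr// ltr_pMr// ltr1n.
move=> /nbhs_inftyP[_ [M AM]]; exists (fin (`|M| + 1)); split.
  by exists (`|M| + 1) => //=; rewrite gt_eqF// ltr_wpDl.
apply: AM; apply: (lt_le_trans _ (ler_norm _)).
by rewrite (le_lt_trans (ler_norm _))// ltrDl.
Qed.

End xreal.

(** * Half-angle tangents *)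

Section half_tan.
Context {R : realType}.
Implicit Types (r t p q k : R) (x : xreal R).

Lemma xquot_eq (p q p' q' : R) : (q == 0) = (q' == 0) -> p * q' = p' * q ->
  xquot p q = xquot p' q'.
Proof.
rewrite /xquot => qq' e; rewrite -qq'; case: ifPn => // q0; congr fin.
by apply/eqP; rewrite eqr_div ?e// -qq'.
Qed.

Lemma xquotZ k p q : k != 0 -> xquot (k * p) (k * q) = xquot p q.
Proof.
by move=> k0; apply: xquot_eq; [rewrite mulf_eq0 (negbTE k0)|ring].
Qed.

Lemma half_tanE r : half_tan r = xquot (sin r) (1 + cos r).
Proof.
rewrite /half_tan; set h := r / 2.
have -> : r = h *+ 2 by rewrite /h -mulr_natr divfK.
rewrite sin_mulr2n cos_mulr2n.
rewrite (_ : 1 + (_ - 1) = cos h * (cos h *+ 2)); last by ring.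
rewrite (_ : _ *+ 2 = sin h * (cos h *+ 2)); last by ring.
(* When cos h = 0, numerator and denominator both vanish; [xquot] tests the denominator only and
   still returns infinity, as required. *)
have [h0|h0] := eqVneq (cos h) 0; first by rewrite h0 mul0r /xquot eqxx.
rewrite [X in xquot X](mulrC) [X in xquot _ X](mulrC) xquotZ ?mulrn_eq0//.
by rewrite /xquot (negbTE h0).
Qed.

(** These are the half-angle formulas in homogeneous coordinates (p, q), which treat infinity (q =
    0) on the same footing as the finite values. *)
Lemma half_tan_xquot r p q : p ^+ 2 + q ^+ 2 != 0 -> half_tan r = xquot p q ->
  cos r = (q ^+ 2 - p ^+ 2) / (p ^+ 2 + q ^+ 2) /\
  sin r = 2 * p * q / (p ^+ 2 + q ^+ 2).
Proof.
rewrite half_tanE /xquot => pq0; have h := sin2cos2 r.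
case: eqVneq => [c0|c0]; case: eqVneq => [q0|q0] //.
  have c1 : cos r = - 1 by lra.
  have s0 : sin r = 0 by apply/eqP; rewrite -sqrf_eq0 h c1; apply/eqP; ring.
  rewrite c1 s0 q0; rewrite q0 expr0n addr0 in pq0 *.
  by rewrite mulr0 mul0r sub0r mulNr divff.
move=> [e]; have es : sin r = p / q * (1 + cos r) by rewrite -e divfK.
(* This is sin^2 = 1 - cos^2 with sin r = p / q * (1 + cos r), multiplied by q^2; the factor 1 + cos
   r is nonzero here. *)
have : (1 + cos r) * (p ^+ 2 * (1 + cos r) - q ^+ 2 * (1 - cos r)) = 0.
  transitivity (q ^+ 2 * ((p / q * (1 + cos r)) ^+ 2 - (1 - cos r ^+ 2))).
    by field.
  by rewrite -es h subrr mulr0.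
move=> /eqP; rewrite mulf_eq0 (negbTE c0) /= => /eqP e2.
have ec : cos r = (q ^+ 2 - p ^+ 2) / (p ^+ 2 + q ^+ 2).
  by apply: (canRL (mulfK pq0)); lra.
by split=> //; rewrite es ec; field; rewrite pq0.
Qed.

(** Lifting points to angles replaces the case distinction at infinity by uniform formulas in cos r
    and sin r. *)
Lemma half_tan_surj x : exists r, half_tan r = x.
Proof.
case: x => [t|].
  exists (atan t * 2); rewrite /half_tan mulfK//.
  rewrite gt_eqF ?atanK// cos_gt0_pihalf//.
  by rewrite atan_gtNpi2 atan_ltpi2.
by exists pi; rewrite /half_tan cos_pihalf eqxx.
Qed.

Lemma half_tanN r : half_tan (- r) = xopp (half_tan r).
Proof.
rewrite /half_tan mulNr cosN tanN; by case: ifP => _; exact: erefl.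
Qed.

Lemma half_tan_pi : half_tan pi = infty :> xreal R.
Proof. by rewrite /half_tan cos_pihalf eqxx. Qed.

Lemma half_tan_fin r t : half_tan r = fin t ->
  cos r = (1 - t ^+ 2) / (1 + t ^+ 2) /\ sin r = 2 * t / (1 + t ^+ 2).
Proof.
have t1 : t ^+ 2 + 1 ^+ 2 != 0 by rewrite gt_eqF// ltr_wpDl ?sqr_ge0// expr1n.
move=> e; have := half_tan_xquot r t 1 t1.
rewrite /xquot oner_eq0 divr1 => /(_ e).
by rewrite expr1n mulr1 (addrC 1 (t ^+ 2)).
Qed.

Lemma half_tan_infty r : half_tan r = infty -> cos r = -1 /\ sin r = 0.
Proof.
have t1 : 1 ^+ 2 + 0 ^+ 2 != 0 :> R by rewrite expr0n addr0 expr1n oner_neq0.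
move=> e; have := half_tan_xquot r 1 0 t1.
rewrite /xquot eqxx => /(_ e).
by rewrite expr1n expr0n addr0 mulr0 mul0r sub0r divr1.
Qed.

Lemma circle_point_xquot p q : p ^+ 2 + q ^+ 2 != 0 ->
  circle_point (xquot p q) = \row_j nth 0
    [:: (q ^+ 2 - p ^+ 2) / (p ^+ 2 + q ^+ 2); 2 * p * q / (p ^+ 2 + q ^+ 2)] j.
Proof.
rewrite /xquot => pq0; case: eqVneq => [q0|q0] /=.
  apply/rowP => j; rewrite !mxE q0; rewrite q0 expr0n addr0 in pq0 *.
  by rewrite mulr0 mul0r sub0r mulNr divff.
apply/rowP => -[[|[|//]] ?]; rewrite !mxE/=; field.
  by rewrite q0 pq0.
by rewrite q0 pq0.
Qed.

Lemma circle_pointE r : circle_point (half_tan r) = \row_j nth 0 [:: cos r; sin r] j.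
Proof.
case e : (half_tan r) => [t|] /=.
  by have [-> ->] := half_tan_fin _ _ e.
by have [-> ->] := half_tan_infty _ e.
Qed.

End half_tan.

(** * The two branches *)

Section deltoid.
Context {R : realType}.
Variables (a b : R).
Hypotheses (a0 : 0 < sin a) (b0 : 0 < sin b).
Hypotheses (sD : sin (b + a) != 0) (sB : sin (b - a) != 0).
Implicit Types (r t : R) (x : xreal R).

(** This and [sB'] are the values of [deltoid_num a b] at 1 and -1. *)
Let sD' : cos a * sin b + sin a * cos b != 0.
Proof. by have := sD; rewrite sinD; congr (_ != 0); ring. Qed.

Let sB' : cos a * sin b - sin a * cos b != 0.
Proof. by have := sB; rewrite sinB; congr (_ != 0); ring. Qed.

(** If the second square vanishes then s = 0 and c is 1 or -1, where [deltoid_num a b c] is sin (b +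
    a) or sin (b - a). *)
Lemma deltoid_den_gt0 (c s : R) : c ^+ 2 + s ^+ 2 = 1 ->
  0 < deltoid_num a b c ^+ 2 + (sin a * s) ^+ 2.
Proof.
move=> cs; rewrite lt0r addr_ge0 ?sqr_ge0// andbT.
rewrite paddr_eq0 ?sqr_ge0// !sqrf_eq0 mulf_eq0 (gt_eqF a0) /=; apply/negP => /andP[].
rewrite /deltoid_num => + /eqP s0; move: cs; rewrite s0 expr0n addr0 => /eqP.
rewrite sqrf_eq1 => /orP[]/eqP->; rewrite ?mulrN mulr1; exact/negP.
Qed.

(** Both sides equal 1 - E^2, where E = cos a * cos b - sin a * sin b * c, symmetric in a and b, is
    the cosine of the diagonal of the linkage. *)
Lemma deltoid_denE (c s : R) : c ^+ 2 + s ^+ 2 = 1 ->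
  deltoid_num b a c ^+ 2 + (sin b * s) ^+ 2 = deltoid_num a b c ^+ 2 + (sin a * s) ^+ 2.
Proof.
move=> cs; have ha := sin2cos2 a; have hb := sin2cos2 b.
have hs : s ^+ 2 = 1 - c ^+ 2 by rewrite -cs addrC addKr.
by rewrite /deltoid_num; ring: ha hb hs.
Qed.

Lemma deltoid_branchE r : deltoid_branch a b (half_tan r) =
  (half_tan r, xquot (deltoid_num a b (cos r)) (sin a * sin r),
   half_tan r, xquot (deltoid_num b a (cos r)) (sin b * sin r)).
Proof.
case e : (half_tan r) => [t|]; last first.
  have [-> ->] := half_tan_infty _ e.
  by rewrite /= !mulr0 /xquot eqxx.
have [-> ->] := half_tan_fin _ _ e.
have t1 : 1 + t ^+ 2 != 0 by rewrite gt_eqF// ltr_wpDr ?sqr_ge0.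
rewrite /= -[X in (_, X, _, _)](xquotZ (1 + t ^+ 2)^-1) ?invr_eq0//.
rewrite -[X in (_, _, _, X)](xquotZ (1 + t ^+ 2)^-1) ?invr_eq0//.
rewrite !sinB !sinD.
by congr (_, xquot _ _, _, xquot _ _); rewrite /deltoid_num; field.
Qed.

(** The first relation is the cross-multiplied equality of sin r / (1 + cos r) and p / q; the second
    ensures q = 0 when 1 + cos r = 0. *)
Lemma half_tan_eq_xquot r (p q : R) : p ^+ 2 + q ^+ 2 != 0 ->
  (1 + cos r) * p = sin r * q -> sin r * p + cos r * q = q ->
  half_tan r = xquot p q.
Proof.
move=> pq e1 e2; rewrite half_tanE; apply: xquot_eq; last by rewrite -e1 mulrC.
have h := sin2cos2 r.
apply/eqP/eqP => [c0|q0].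
  have c1 : cos r = -1 by lra.
  have s0 : sin r = 0 by apply/eqP; rewrite -sqrf_eq0 h c1; apply/eqP; ring.
  by move: e2; rewrite c1 s0; lra.
have p0 : p != 0 by apply: contraNneq pq => ->; rewrite q0 expr0n addr0.
by apply: (mulIf p0); rewrite e1 q0 mulr0 mul0r.
Qed.

Lemma half_tan_eq_infty r (p q : R) : p ^+ 2 + q ^+ 2 != 0 ->
  (1 + cos r) * p = sin r * q -> sin r * p + cos r * q = - q ->
  half_tan r = infty.
Proof.
move=> pq e1 e2; rewrite half_tanE /xquot ifT//; apply/eqP/(mulIf pq).
rewrite mul0r.
(* This combination of the two relations eliminates sin r. *)
transitivity (p * ((1 + cos r) * p - sin r * q) + q * (sin r * p + cos r * q + q)).
  by ring.
by rewrite e1 e2; ring.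
Qed.

Lemma solutions_deltoid : solutions a b b a =
  range (deltoid_branch a b) `|` range (@deltoid_branch_at_infinity R).
Proof.
apply/seteqP; split=> [_ [rx [ry [rz [rw [cc ->]]]]]|_ [] [x _ <-]].
- have [] := closed_chain_deltoidE _ _ _ _ _ _ cc a0 b0.
  move=> czx ey ey' ew ew'.
  have D0 := lt0r_neq0 (deltoid_den_gt0 _ _ (cos2Dsin2 rx)).
  have D0' : deltoid_num b a (cos rx) ^+ 2 + (sin b * sin rx) ^+ 2 != 0.
    by rewrite deltoid_denE ?cos2Dsin2.
  have : sin rz ^+ 2 == sin rx ^+ 2 by rewrite !sin2cos2 czx.
  rewrite eqf_sqr => /orP[]/eqP szx; [left|right]; exists (half_tan rx) => //.
    have -> : half_tan rz = half_tan rx by rewrite !half_tanE czx szx.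
    rewrite szx in ey' ew ew'.
    rewrite deltoid_branchE -(half_tan_eq_xquot ry _ _ D0 ey ey').
    by rewrite -(half_tan_eq_xquot rw _ _ D0' ew ew').
  have -> : half_tan rz = xopp (half_tan rx).
    by rewrite -half_tanN !half_tanE czx szx cosN sinN.
  rewrite szx !mulrN in ey' ew ew'.
  rewrite /deltoid_branch_at_infinity (half_tan_eq_infty _ _ _ D0 ey ey').
  (* The relations for [rw] involve sin rz = - sin rx, whence the sign of the second argument. *)
  rewrite (half_tan_eq_infty rw (deltoid_num b a (cos rx))
    (- (sin b * sin rx))) ?sqrrN//.
  + by rewrite ew mulrN.
  + by rewrite opprK mulrN.
- have [r <-] := half_tan_surj x; rewrite deltoid_branchE.
  have [ry ey] := half_tan_surj (xquot (deltoid_num a b (cos r)) (sin a * sin r)).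
  have [rw ew] := half_tan_surj (xquot (deltoid_num b a (cos r)) (sin b * sin r)).
  exists r, ry, r, rw; split; last by rewrite ey ew.
  have D0 := lt0r_neq0 (deltoid_den_gt0 _ _ (cos2Dsin2 r)).
  have DE := deltoid_denE _ _ (cos2Dsin2 r).
  have [cy sy] := half_tan_xquot _ _ _ D0 ey.
  have [|cw sw] := half_tan_xquot _ _ _ _ ew; first by rewrite DE.
  by apply: closed_chain_deltoid => //; rewrite ?cy ?sy ?cw ?sw// DE.
- have [r <-] := half_tan_surj x.
  exists r, pi, (- r), pi; split; last by rewrite half_tanN half_tan_pi.
  apply/closed_chainE; rewrite !mulmx_mx3 !cosN !sinN cospi sinpi.
  by apply/mx3P; split; split; ring.
Qed.

Lemma deltoid_branch0 :
  deltoid_branch a b (fin 0) = (fin 0, infty, fin 0, infty).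
Proof. by rewrite /= !mulr0 !mul0r /xquot eqxx. Qed.

Lemma deltoid_branch_neq0 t : t != 0 -> deltoid_branch a b (fin t) =
  (fin t, fin ((sin (b - a) * t ^+ 2 + sin (b + a)) / (2 * t * sin a)),
   fin t, fin ((sin (a - b) * t ^+ 2 + sin (a + b)) / (2 * t * sin b))).
Proof.
by move=> t0; rewrite /= /xquot !mulf_eq0 pnatr_eq0 (negbTE t0) !gt_eqF.
Qed.

Lemma finite_solutions_deltoid : finite_solutions a b b a =
  deltoid_branch a b @` (@fin R @` [set t : R | t != 0]).
Proof.
rewrite /finite_solutions solutions_deltoid; apply/seteqP; split.
  move=> _ [[[x _ <-]|[x _ <-]] [x' [y [z [w]]]]]; last by [].
  case: x => [t|//]; have [->|t0 _] := eqVneq t 0; first by rewrite deltoid_branch0.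
  by exists (fin t) => //; exists t.
move=> _ [_ [t /= t0 <-] <-]; split; first by left; exists (fin t).
rewrite deltoid_branch_neq0//.
by do 4 eexists.
Qed.

(** The first curve is at infinity only for x = 0 and x = infinity. As [xopp] fixes both, these
    points already lie on the second curve. *)
Lemma solutions_at_infinity_deltoid : solutions_at_infinity a b b a =
  range (@deltoid_branch_at_infinity R).
Proof.
rewrite /solutions_at_infinity solutions_deltoid; apply/seteqP; split.
  move=> _ [[[x _ <-]|[x _ <-]]]; last by exists x.
  case: x => [t|]; last by exists infty.
  have [->|t0] := eqVneq t 0.
    rewrite deltoid_branch0 => _; exists (fin 0) => //.
    by rewrite /deltoid_branch_at_infinity /= oppr0.
  by rewrite deltoid_branch_neq0// => -[].
move=> _ [x _ <-]; split; first by right; exists x.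
by constructor 2.
Qed.

End deltoid.

(** * Diffeomorphisms with the circle *)

Section torus.
Context {R : realType}.

(** The point (c, s) comes from the half-angle tangent s / (1 + c), and (-1, 0) from infinity. *)
Lemma unit_circleP (u : 'rV[R]_2) :
  unit_circle u <-> exists x, circle_point x = u.
Proof.
split=> [u1|[x <-]].
  have [u0|u0] := eqVneq (1 + u ord0 ord0) 0.
    have c1 : u ord0 ord0 = -1 by lra.
    have s0 : u ord0 ord_max = 0.
      apply/eqP; rewrite -sqrf_eq0; apply/eqP.
      by move: u1; rewrite /unit_circle/= c1; lra.
    exists infty; apply/rowP => -[[|[|//]] i2]; rewrite !mxE/=.
      by rewrite -c1; congr (u _ _); exact: val_inj.
    by rewrite -s0; congr (u _ _); exact: val_inj.
  have D : (u ord0 ord_max) ^+ 2 + (1 + u ord0 ord0) ^+ 2 != 0.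
    rewrite (_ : _ + _ = 2 * (1 + u ord0 ord0)); last first.
      by move: u1; rewrite /unit_circle /=; lra.
    by rewrite mulf_neq0.
  exists (xquot (u ord0 ord_max) (1 + u ord0 ord0)).
  have E : (u ord0 ord_max) ^+ 2 = 1 - u ord0 ord0 ^+ 2.
    by move: u1; rewrite /unit_circle /=; lra.
  rewrite circle_point_xquot//.
  apply/rowP => -[[|[|//]] i2]; rewrite !mxE/=.
    rewrite (_ : Ordinal i2 = ord0); last exact: val_inj.
    by apply: (mulIf D); rewrite divfK// ; ring: E.
  rewrite (_ : Ordinal i2 = ord_max); last exact: val_inj.
  by apply: (mulIf D); rewrite divfK// ; ring: E.
have [r <-] := half_tan_surj x.
by rewrite circle_pointE /unit_circle /= !mxE /= cos2Dsin2.
Qed.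

(** The first row of a torus point is the circle point of x, so the linear map [row ord0] has [g] as
    its inverse on the curve. *)
Lemma diffeomorphic_to_circle_range (q : xreal R -> xreal4 R)
    (g : 'rV[R]_2 -> 'M[R]_(4, 2)) :
  (forall x, (q x).1.1.1 = x) ->
  (forall k, Ck_on k setT g) ->
  (forall x, g (circle_point x) = torus_point (q x)) ->
  diffeomorphic_to_circle (range q).
Proof.
move=> qx gC gq.
have row0 x : row ord0 (torus_point (q x)) = circle_point x.
  rewrite -[in RHS](qx x); case: (q x) => [[[x' y] z] w].
  by rewrite rowK.
exists (row ord0), g; split.
- apply: smooth_on_Ck => k; apply: Ck_on_linear => M.
  apply: mx_continuous => i j.
  rewrite (_ : (fun u => _) = fun u : 'M[R]_(4, 2) => u ord0 j).
    exact: coord_continuous.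
  by apply/funext => u; rewrite mxE.
- exact: smooth_on_Ck.
- move=> _ [_ [x _ <-] <-]; rewrite row0 gq; split=> //.
  by apply/unit_circleP; exists x.
- move=> _ /unit_circleP[x <-]; rewrite gq row0; split=> //.
  by exists (q x) => //; exists x.
Qed.

(** The indices are natural numbers, to be split by plain case analysis; outside the matrix the
    entry is the constant 0. *)
Lemma Ck_on_mx42 k (f : 'rV[R]_2 -> seq (seq R)) :
  (forall i j, Ck_on k setT (fun u => nth 0 (nth [::] (f u) i) j)) ->
  Ck_on k setT (fun u => \matrix_(i < 4, j < 2) nth 0 (nth [::] (f u) i) j).
Proof.
move=> fC; apply: Ck_on_mx => i j.
rewrite (_ : (fun u => _) = fun u => nth 0 (nth [::] (f u) i) j) //.
by apply/funext => u; rewrite mxE.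
Qed.

Lemma diffeomorphic_deltoid_branch_at_infinity :
  diffeomorphic_to_circle (range (@deltoid_branch_at_infinity R)).
Proof.
pose F (u : 'rV[R]_2) := [:: [:: u ord0 ord0; u ord0 ord_max]; [:: -1; 0];
                [:: u ord0 ord0; - u ord0 ord_max]; [:: -1; 0]].
apply: (diffeomorphic_to_circle_range _
  (fun u => \matrix_(i < 4, j < 2) nth 0 (nth [::] (F u) i) j)) => //.
  move=> k; apply: Ck_on_mx42 => -[|[|[|[|i]]]] [|[|j]] /=;
    rewrite ?nth_nil/=; try exact: Ck_on_cst; try exact: Ck_on_coord.
  by apply: Ck_onN; exact: Ck_on_coord.
move=> x; have [r <-] := half_tan_surj x.
rewrite /deltoid_branch_at_infinity -half_tanN.
apply/matrixP => i j; rewrite mxE /torus_point mxE.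
by case: i j => [[|[|[|[|//]]]] ?] [[|[|//]] ?];
  rewrite /F /= ?circle_pointE !mxE /= ?cosN ?sinN.
Qed.

End torus.

(** * Closure and smooth structure of the first branch *)

Lemma pair_continuous (T S S' : topologicalType) (f : T -> S) (g : T -> S') :
  continuous f -> continuous g -> continuous (fun x => (f x, g x)).
Proof. by move=> fc gc x; apply: cvg_pair; [exact: fc|exact: gc]. Qed.

Lemma hausdorff_prod (S S' : topologicalType) :
  hausdorff_space S -> hausdorff_space S' -> hausdorff_space (S * S')%type.
Proof.
move=> hS hS' [x x'] [y y'] xy; congr pair; [apply: hS|apply: hS'] => A B xA yB.
- have [] := xy (fst @^-1` A) (fst @^-1` B) (cvg_fst xA) (cvg_fst yB).
  by move=> -[z z'] [/= zA zB]; exists z.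
- have [] := xy (snd @^-1` A) (snd @^-1` B) (cvg_snd xA) (cvg_snd yB).
  by move=> -[z z'] [/= zA zB]; exists z'.
Qed.

Section branch.
Context {R : realType}.

(** At t = 0 the denominator vanishes but B does not, so [cvg_xquot] applies; at infinity the
    quadratic numerator outgrows the linear denominator. *)
Lemma xquot_continuous (A B C : R) : A != 0 -> B != 0 -> C != 0 ->
  continuous (fun x : xreal R =>
    if x is Some t then xquot (A * t ^+ 2 + B) (2 * t * C) else infty).
Proof.
move=> A0 B0 C0 [t|]; last first.
  apply: (cvg_infty _ (nbhs (infty : xreal R)) _ (nbhs_filter _)) => M.
  apply/nbhs_inftyP; split=> //=.
  have [A1 C1] : 0 < `|A| /\ 0 < `|C| by rewrite !normr_gt0.
  (* Beyond this bound |t| > 1 and |A| (|t| - 1) > |B| + 2 |M| |C|; multiplying by |t| gives |A| t^2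
     - |B| > 2 |M| |C| |t|. *)
  exists ((`|B| + 2 * `|M| * `|C|) / `|A| + 1) => t.
  have B1 : 0 <= `|B| by [].
  have MC : 0 <= 2 * `|M| * `|C| by rewrite !mulr_ge0.
  rewrite -ltrBrDr ltr_pdivrMr// => ht.
  have t1 : 1 < `|t| by nra.
  have t0 : t != 0 by rewrite -normr_gt0; lra.
  rewrite /xquot !mulf_eq0 pnatr_eq0 (negbTE t0) (negbTE C0) /=.
  apply: (le_lt_trans (ler_norm M)).
  rewrite normrM normfV !normrM (gtr0_norm (ltr0Sn _ 1)) ltr_pdivlMr; last first.
    by rewrite !mulr_gt0// normr_gt0.
  apply: (@lt_le_trans _ _ (`|A * t ^+ 2| - `|B|)).
    rewrite normrM normrX; nra.
  by rewrite -[X in _ <= `|_ + X|]opprK -[X in _ - X <= _]normrN lerB_dist.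
suff : (fun t : R => xquot (A * t ^+ 2 + B) (2 * t * C)) @ t -->
    xquot (A * t ^+ 2 + B) (2 * t * C) by [].
apply: cvg_xquot.
- apply/eqP => -[e1 /eqP]; rewrite !mulf_eq0 pnatr_eq0 (negbTE C0) orbF /=.
  by move=> /eqP t0; move: e1; rewrite t0 expr0n mulr0 add0r; apply/eqP.
- apply: cvgD; last exact: cvg_cst.
  by apply: cvgM; [exact: cvg_cst|exact: exprn_continuous].
- apply: cvgM; last exact: cvg_cst.
  by apply: cvgM; [exact: cvg_cst|exact: cvg_id].
Qed.

Variables (a b : R).
Hypotheses (a0 : 0 < sin a) (b0 : 0 < sin b).
Hypotheses (sD : sin (b + a) != 0) (sB : sin (b - a) != 0).

Lemma deltoid_branch_continuous : continuous (deltoid_branch a b).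
Proof.
pose h A B C (x : xreal R) : xreal R :=
  if x is Some t then xquot (A * t ^+ 2 + B) (2 * t * C) else infty.
have -> : deltoid_branch a b = fun x : xreal R =>
    (x, h (sin (b - a)) (sin (b + a)) (sin a) x, x,
     h (sin (a - b)) (sin (a + b)) (sin b) x).
  by apply/funext => -[t|].
have aD : sin (a + b) != 0 by rewrite addrC.
have aB : sin (a - b) != 0 by rewrite -opprB sinN oppr_eq0.
have idc : continuous (id : xreal R -> xreal R) by move=> x; exact: cvg_id.
have hy : continuous (h (sin (b - a)) (sin (b + a)) (sin a)).
  by apply: xquot_continuous => //; exact: lt0r_neq0.
have hw : continuous (h (sin (a - b)) (sin (a + b)) (sin b)).
  by apply: xquot_continuous => //; exact: lt0r_neq0.
exact: (pair_continuous _ _ _ _ _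
  (pair_continuous _ _ _ _ _ (pair_continuous _ _ _ _ _ idc hy) idc) hw).
Qed.

Lemma closure_deltoid_branch :
  closure (deltoid_branch a b @` (@fin R @` [set t : R | t != 0])) =
  range (deltoid_branch a b).
Proof.
apply/seteqP; split.
  rewrite [X in _ `<=` X](closure_id _).1; last first.
    apply: range_closed; last exact: deltoid_branch_continuous.
      exact: one_point_compactification_compact.
    do 3 (apply: hausdorff_prod; last exact: xreal_hausdorff).
    exact: xreal_hausdorff.
  by apply: closure_subset => _ [x _ <-]; exists x.
move=> _ [x _ <-] N /deltoid_branch_continuous xN.
have [y [yE yN]] := dense_fin_neq0 x _ xN.
by exists (deltoid_branch a b y); split=> //; exists y.
Qed.

Lemma diffeomorphic_deltoid_branch :
  diffeomorphic_to_circle (range (deltoid_branch a b)).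
Proof.
pose c (u : 'rV[R]_2) := u ord0 ord0; pose s (u : 'rV[R]_2) := u ord0 ord_max.
pose p u := deltoid_num a b (c u).
pose p' u := deltoid_num b a (c u).
pose q u := sin a * s u; pose q' u := sin b * s u.
(* The last square vanishes on the circle and makes [D] positive everywhere. *)
pose D u := p u * p u + q u * q u +
  (c u * c u + s u * s u - 1) * (c u * c u + s u * s u - 1).
have D0 u : D u != 0.
  have [u1|u1] := eqVneq (c u ^+ 2 + s u ^+ 2) 1.
    rewrite gt_eqF// /D -!expr2 u1 subrr expr0n addr0.
    exact: (deltoid_den_gt0 a b a0 sD sB _ _ u1).
  rewrite gt_eqF// /D -!expr2 ltr_wpDl ?addr_ge0 ?sqr_ge0//.
  by rewrite lt0r sqr_ge0 sqrf_eq0 subr_eq0 u1.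
(* The second and fourth rows are the cosine and sine with half-angle tangents p / q and p' / q'; on
   the circle [D] is the right denominator for both, by [deltoid_denE]. *)
pose F u := [:: [:: c u; s u];
  [:: (q u * q u - p u * p u) / D u; 2 * p u * q u / D u];
  [:: c u; s u];
  [:: (q' u * q' u - p' u * p' u) / D u; 2 * p' u * q' u / D u]].
have cC k : Ck_on k setT c by exact: Ck_on_coord.
have sC k : Ck_on k setT s by exact: Ck_on_coord.
have K k r : Ck_on k setT (fun _ : 'rV[R]_2 => r) by exact: Ck_on_cst.
have pC k : Ck_on k setT p.
  by rewrite /p /deltoid_num; do ?[apply: Ck_onD|apply: Ck_onM].
have p'C k : Ck_on k setT p'.
  by rewrite /p' /deltoid_num; do ?[apply: Ck_onD|apply: Ck_onM].
have qC k : Ck_on k setT q by do ?[apply: Ck_onD|apply: Ck_onM].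
have q'C k : Ck_on k setT q' by do ?[apply: Ck_onD|apply: Ck_onM].
have VC k : Ck_on k setT (fun u => (D u)^-1).
  by apply: Ck_onV => //; do ?[apply: Ck_onD|apply: Ck_onM].
apply: (diffeomorphic_to_circle_range _
  (fun u => \matrix_(i < 4, j < 2) nth 0 (nth [::] (F u) i) j)).
- by case.
- move=> k; apply: Ck_on_mx42 => -[|[|[|[|i]]]] [|[|j]] /=; rewrite ?nth_nil/= //;
    by apply: Ck_onM => //; do ?[apply: Ck_onD|apply: Ck_onM|apply: Ck_onN].
move=> x; have [r <-] := half_tan_surj x.
rewrite (deltoid_branchE a b).
have h := cos2Dsin2 r.
have e := deltoid_denE a b _ _ h.
have d0 := lt0r_neq0 (deltoid_den_gt0 a b a0 sD sB _ _ h).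
(* Naming the circle point lets the completed-line values be generalized afterwards, leaving only
   their images under [circle_point]. *)
have [u eu] : {u | u = circle_point (half_tan r)}.
  by exists (circle_point (half_tan r)).
rewrite -eu.
have cu : c u = cos r by rewrite /c eu circle_pointE mxE.
have su : s u = sin r by rewrite /s eu circle_pointE mxE.
have Du : D u = deltoid_num a b (cos r) ^+ 2 + (sin a * sin r) ^+ 2.
  by rewrite /D /p /q cu su -!expr2 h subrr expr0n addr0.
have d0' : deltoid_num b a (cos r) ^+ 2 + (sin b * sin r) ^+ 2 != 0.
  by rewrite e.
move: (circle_pointE r) (circle_point_xquot _ _ d0) (circle_point_xquot _ _ d0').
rewrite e -Du -cu -su; move: (half_tan r) (xquot _ _) (xquot _ _) {eu}.
move=> x1 x2 x3 x1E x2E x3E.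
apply/matrixP => i j; rewrite mxE /torus_point mxE.
by case: i j => [[|[|[|[|//]]]] ?] [[|[|//]] ?];
  rewrite /F /= ?x1E ?x2E ?x3E mxE /= -?expr2.
Qed.

End branch.

Lemma sin_neq0 (R : realType) (t : R) :
  0 < t < pi *+ 2 -> t <> pi -> sin t != 0.
Proof.
move=> /andP[t0 t2] tpi; have [tlt|tgt|//] := ltgtP t pi.
  by rewrite gt_eqF ?sin_gt0_pi// t0.
rewrite -(subrK pi t) sinDpi oppr_eq0 gt_eqF ?sin_gt0_pi//.
by rewrite subr_gt0 tgt ltrBlDr -mulr2n.
Qed.

Theorem mainTheorem9 (R : realType) (alpha beta gamma delta : R)
    (halpha : 0 < alpha < pi) (hbeta : 0 < beta < pi)
    (hgamma : 0 < gamma < pi) (hdelta : 0 < delta < pi)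
    (hda : delta = alpha) (hgb : gamma = beta)
    (hba : beta <> alpha) (hpi : alpha + beta <> pi) :
  let branch := closure (finite_solutions alpha beta gamma delta) in
  let branch_at_infinity := solutions_at_infinity alpha beta gamma delta in
  [/\ finite_solutions alpha beta gamma delta =
        [set (fin x,
              fin ((sin (beta - alpha) * x ^+ 2 + sin (beta + alpha)) /
                   (2 * x * sin alpha)),
              fin x,
              fin ((sin (alpha - beta) * x ^+ 2 + sin (alpha + beta)) /
                   (2 * x * sin beta))) | x in [set x : R | x != 0]],
      branch = range (@deltoid_branch R alpha beta) &
      diffeomorphic_to_circle branch] /\
  [/\ branch_at_infinity = range (@deltoid_branch_at_infinity R),
      diffeomorphic_to_circle branch_at_infinity &
      branch_at_infinity <> branch].
Proof.
rewrite {}hda {}hgb {hgamma hdelta}.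
have a0 : 0 < sin alpha by exact: sin_gt0_pi.
have b0 : 0 < sin beta by exact: sin_gt0_pi.
have sD : sin (beta + alpha) != 0.
  by apply: sin_neq0; [lra|rewrite addrC].
have sB : sin (beta - alpha) != 0.
  have [lt|lt|//] := ltgtP beta alpha.
    rewrite -opprB sinN oppr_eq0 gt_eqF// sin_gt0_pi//; lra.
  rewrite gt_eqF// sin_gt0_pi//; lra.
have finE := finite_solutions_deltoid _ _ a0 b0 sD sB.
have infE := solutions_at_infinity_deltoid _ _ a0 b0 sD sB.
have clE := closure_deltoid_branch _ _ a0 b0 sD sB.
move=> /=; rewrite infE finE clE; split; split=> //.
- apply/seteqP; split=> [_ [_ [t t0 <-] <-]|_ [t t0 <-]].
    by exists t => //; rewrite deltoid_branch_neq0.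
  by exists (fin t); [exists t|rewrite deltoid_branch_neq0].
- exact: diffeomorphic_deltoid_branch.
- exact: diffeomorphic_deltoid_branch_at_infinity.
- move=> e.
  (* At x = 1 the first curve has y finite, whereas y is infinite all along the second. *)
  have : range (deltoid_branch alpha beta) (deltoid_branch alpha beta (fin 1)).
    by exists (fin 1).
  rewrite -e deltoid_branch_neq0 ?oner_neq0// => -[x _].
  by rewrite /deltoid_branch_at_infinity.
Qed.
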